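(* Let $\mathcal{B}$ be the smallest collection of ideals on $\mathbb{N}$ containing the ideal of finite sets and closed under countable direct sums and the operation of taking orthogonal. Then $\mathcal{B}$ has, up to isomorphism, exactly $\aleph_1$ members, and all of them are Fréchet ideals. Moreover, every ideal in $\mathcal{B}$ is an $F_{\sigma\delta}$ subset of $2^{\mathbb{N}}$.
   Context: An ideal over a countable set $X$ is a family of subsets of $X$ that contains every finite subset of $X$ and is closed under taking subsets and finite unions; the trivial ideal $\mathcal{P}(X)$ is allowed. Subsets of $X$ are identified with their characteristic functions, so an ideal is a subset of $2^X$ and its descriptive complexity is that of this subset. Two ideals $I$ on $X$ and $J$ on $Y$ are isomorphic if there is a bijection $f:X\to Y$ such that $A\in I$ iff $f[A]\in J$. For an ideal $I$ on $X$, its orthogonal is $I^\perp=\{B\subseteq X: A\cap B \text{ is finite for all } A\in I\}$; $I$ is Fréchet if $I=I^{\perp\perp}$. Direct sum: given finitely or countably many ideals $I_n$ on countably infinite sets $X_n$, take a partition $\{K_n\}$ of $\mathbb{N}$ and an isomorphic copy $I_n'$ of $I_n$ on $K_n$; then $A\in\bigoplus_n I_n$ iff $A\cap K_n\in I_n'$ for all $n$. This is well defined up to isomorphism. The collection $\mathcal{B}$ is regarded as closed under isomorphism, and ''countable'' direct sums include finite ones. *)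

(* Defs.v *)
From mathcomp Require Import all_boot all_order all_algebra.
From mathcomp Require Import all_classical all_reals all_analysis.
From mathcomp Require Import borel_hierarchy.

Set Implicit Arguments.
Unset Strict Implicit.
Unset Printing Implicit Defensive.

Local Open Scope classical_set_scope.
Local Open Scope card_scope.

(* The whole powerset is allowed as an ideal. *)
Definition set_ideal {T : Type} (I : set (set T)) : Prop :=
  [/\ forall A, finite_set A -> I A,
      forall A B, A `<=` B -> I B -> I A
    & forall A B, I A -> I B -> I (A `|` B)].

Definition Fin {T : Type} : set (set T) := [set A | finite_set A].

(* [I] is read as an ideal on [X] and [J] as an ideal on [Y]: only the members
   of [I] included in [X] and the members of [J] included in [Y] matter. *)
Definition ideal_iso {T U : Type} (X : set T) (Y : set U)
    (I : set (set T)) (J : set (set U)) : Prop :=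
  exists f : T -> U, set_bij X Y f /\
    forall A, A `<=` X -> (I A <-> J (f @` A)).

Definition orthogonal {T : Type} (I : set (set T)) : set (set T) :=
  [set B | forall A, I A -> finite_set (A `&` B)].

Definition Frechet {T : Type} (I : set (set T)) : Prop :=
  I = orthogonal (orthogonal I).

(* [S] is a direct sum of the family of ideals [I n], [n \in D], for some choice
   of the pieces [K n] and of the copies [I' n].  The index set [D] is finite or
   countably infinite; it is nonempty because the pieces cover [nat]. *)
Definition is_direct_sum (D : set nat) (I : nat -> set (set nat))
    (S : set (set nat)) : Prop :=
  exists (K : nat -> set nat) (I' : nat -> set (set nat)),
    [/\ partition D K [set: nat],
        forall n, D n -> ideal_iso [set: nat] (K n) (I n) (I' n)
      & forall A, S A <-> (forall n, D n -> I' n (A `&` K n))].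

Definition closed_collection (M : set (set (set nat))) : Prop :=
  [/\ M `<=` set_ideal,
      forall I J, M I -> ideal_iso [set: nat] [set: nat] I J -> M J,
      forall I, M I -> M (orthogonal I)
    & forall D I S, (forall n, D n -> M (I n)) -> is_direct_sum D I S -> M S].

Definition calB : set (set (set nat)) := smallest closed_collection [set Fin].

Definition iso_class (I : set (set nat)) : set (set (set nat)) :=
  [set J | ideal_iso [set: nat] [set: nat] I J].

(* aleph_1 is the least uncountable cardinal. *)
Definition has_card_aleph1 {T : Type} (A : set T) : Prop :=
  ~ countable A /\ forall (U : Type) (B : set U), ~ countable B -> A #<= B.

Definition char_set (I : set (set nat)) : set cantor_space :=
  [set x | I [set n | (x : nat -> bool) n]].

Definition Fsigmadelta {T : topologicalType} (S : set T) : Prop :=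
  exists2 F : nat -> set T, (forall i, Fsigma (F i)) & S = \bigcap_i F i.

(* Main.v *)
Require Import Defs.
From mathcomp Require Import all_boot all_order all_algebra.
From mathcomp Require Import all_classical all_reals all_analysis.
From mathcomp Require Import borel_hierarchy.
From mathcomp Require wochoice.
From Stdlib Require Import Cantor Wellfounded.
(* [orthogonal] would otherwise denote the notion for sesquilinear forms. *)
Import Defs.

Set Implicit Arguments.
Unset Strict Implicit.
Unset Printing Implicit Defensive.

Local Open Scope classical_set_scope.

(* Ordered by embedding as a restriction to an infinite set, two ideals that
   embed in each other are isomorphic (Schröder–Bernstein), and embeddings
   dualize to orthogonals. Let [Q a], for a countable ordinal [a], be the direct
   sum of the [P b], [b < a], each repeated infinitely often, where
   [P b = (Q b)^⊥] and [Q 0] is the powerset. Each of [P a], [Q a] and their sum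
   absorbs a second copy of itself and everything of lower level. So a countable
   direct sum of such ideals reduces to [Q d] plus finitely many summands, [d]
   being least with all but finitely many summands embeddable in [Q d], and
   hence to [P a], [Q a] or their sum: there are at most aleph_1 classes. They
   are uncountably many since [Q a] never embeds in [P a]: all but finitely many
   columns of [Q a] would go into finitely many columns of [P a], so that [P b]
   would embed in [Q b] for some [b < a].

   For the complexity, the ideals [I] such that [I] and its orthogonal are both
   F_sigma_delta are closed under direct sums: the orthogonal of a sum is given
   by an F_sigma_delta condition on each piece and the F_sigma condition of
   meeting only finitely many pieces. *)

(** * Embeddings of ideals *)

Section Embeddings.
Context {T U V : Type}.

(** Relativized to [X] and [Y] so that a carrier can be cut into pieces that are embedded separately
    and glued afterwards. *)
Definition embeds (X : set T) (Y : set U) (I : set (set T)) (J : set (set U)) :=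
  exists f : T -> U,
    [/\ set_fun X Y f, set_inj X f &
        forall A, A `<=` X -> (I A <-> J (f @` A))].

End Embeddings.

Notation "I ≼ J" := (embeds [set: _] [set: _] I J) (at level 70).

Lemma ideal_iso_embeds {T U : Type} (X : set T) (Y : set U) I J :
  ideal_iso X Y I J -> embeds X Y I J.
Proof. by move=> [f [[fXY finj _] fIJ]]; exists f. Qed.

Lemma embedsT {T U : Type} (I : set (set T)) (J : set (set U)) (f : T -> U) :
  injective f -> (forall A, I A <-> J (f @` A)) -> I ≼ J.
Proof. by move=> finj fIJ; exists f; split=> // x y _ _ /finj. Qed.

Lemma embedsTP {T U : Type} (I : set (set T)) (J : set (set U)) :
  I ≼ J -> exists f : T -> U, injective f /\ forall A, I A <-> J (f @` A).
Proof.
move=> [f [_ finj fIJ]]; exists f; split; last by move=> A; exact: fIJ.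
by move=> x y; apply: finj; rewrite inE.
Qed.

Lemma embeds_refl {T : Type} (I : set (set T)) : I ≼ I.
Proof. by apply: (@embedsT _ _ _ _ id) => // A; rewrite image_id. Qed.

Lemma embeds_trans {T U V : Type} (X : set T) (Y : set U) (Z : set V) I J L :
  embeds X Y I J -> embeds Y Z J L -> embeds X Z I L.
Proof.
move=> [f [fXY finj fIJ]] [g [gYZ ginj gJL]]; exists (g \o f); split.
- by move=> x Xx; apply/gYZ/fXY.
- move=> x y Xx Xy /ginj fxy; apply: finj => //; apply: fxy; rewrite inE;
    by apply: fXY; rewrite -inE.
- move=> A AX; rewrite -image_comp fIJ// gJL//.
  by move=> _ [x /AX/fXY Yfx <-].
Qed.

Lemma sub_embeds {T U : Type} (X X' : set T) (Y Y' : set U) I J :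
  X' `<=` X -> Y `<=` Y' -> embeds X Y I J -> embeds X' Y' I J.
Proof.
move=> XX YY [f [fXY finj fIJ]]; exists f; split.
- by move=> x /XX/fXY/YY.
- by move=> x y; rewrite !inE => /XX Xx /XX Xy; apply: finj; rewrite inE.
- by move=> A AX; apply: fIJ => x /AX/XX.
Qed.

Lemma set_idealP {T : Type} (I : set (set T)) : set_ideal I ->
  forall A B, I (A `|` B) <-> I A /\ I B.
Proof.
move=> [_ Isub IU] A B; split=> [IAB|[IA IB]]; last exact: IU.
by split; apply: Isub IAB => x; [left|right].
Qed.

Lemma set_ideal0 {T : Type} (I : set (set T)) : set_ideal I -> I set0.
Proof. by move=> [If _ _]; apply/If/finite_set0. Qed.

Lemma image_preimage_inj {T U : Type} (f : T -> U) (A : set T) :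
  injective f -> f @^-1` (f @` A) = A.
Proof.
by move=> finj; apply/seteqP; split=> [x [y Ay /finj <-//]|x Ax]; exists x.
Qed.

(** * Orthogonals and their behaviour under embeddings *)

Section Orthogonal.
Context {T : Type}.
Implicit Types I : set (set T).

Lemma orthogonal_ideal I : set_ideal (orthogonal I).
Proof.
split=> [A Afin B _|A B AB oB C IC|A B oA oB C IC].
- by apply: sub_finite_set Afin => x [].
- by apply: sub_finite_set (oB _ IC) => x [? /AB].
- by rewrite setIUr finite_setU; split; [exact: oA|exact: oB].
Qed.

Lemma sub_orthogonal2 I : I `<=` orthogonal (orthogonal I).
Proof. by move=> A IA B oB; rewrite setIC; apply: oB. Qed.

Lemma Frechet_orthogonal I : Frechet I -> Frechet (orthogonal I).
Proof. by move=> FI; rewrite /Frechet -{1}FI. Qed.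

End Orthogonal.

Lemma orthogonal_Fin {T : Type} : orthogonal (@Fin T) = [set: set T].
Proof.
apply/seteqP; split=> // A _ B Bfin; apply: sub_finite_set Bfin.
by move=> x [].
Qed.

Lemma orthogonal_setT {T : Type} : orthogonal [set: set T] = Fin.
Proof.
apply/seteqP; split=> [A /(_ A Logic.I)|A Afin B _]; first by rewrite setIid.
by apply: sub_finite_set Afin => x [].
Qed.

(** As [J] is closed under subsets, the preimage of a member of [J] is in [I]. So for sets inside
    the range of [f], testing against [J] amounts to testing against [I]. *)
Lemma embedding_orthogonal {T U : Type} (I : set (set T)) (J : set (set U))
    (f : T -> U) :
  set_ideal J -> injective f -> (forall A, I A <-> J (f @` A)) ->
  forall B, orthogonal I B <-> orthogonal J (f @` B).
Proof.
move=> [_ Jsub _] finj fIJ B; split.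
- move=> oB C JC.
  have IC : I (f @^-1` C).
    by apply/fIJ; apply: Jsub JC => _ [x Cx <-].
  apply: sub_finite_set (finite_image f (oB _ IC)).
  by move=> y [Cy [x Bx fxy]]; exists x => //; split=> //=; rewrite fxy.
- move=> oB A /fIJ/oB fAB.
  have := finite_preimage (f := f) _ fAB.
  have -> : f @^-1` (f @` A `&` f @` B) = A `&` B.
    by rewrite preimage_setI !image_preimage_inj.
  by apply; move=> x y _ _ /finj.
Qed.

Lemma embeds_orthogonal {T U : Type} (I : set (set T)) (J : set (set U)) :
  set_ideal J -> I ≼ J -> orthogonal I ≼ orthogonal J.
Proof.
by move=> idJ /embedsTP[f [finj fIJ]]; apply: (embedsT finj);
  exact: embedding_orthogonal.
Qed.

(** * The Schröder-Bernstein theorem for ideals *)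

(** The points reached by iterating [g \o f] from outside the range of [g]. The Schröder-Bernstein
    bijection is [f] on them and the inverse of [g] elsewhere. *)
Inductive orbit {T U : Type} (f : T -> U) (g : U -> T) : T -> Prop :=
| orbit_base x : ~ range g x -> orbit f g x
| orbit_step x : orbit f g x -> orbit f g (g (f x)).

(* The bijection of the Schröder–Bernstein theorem preserves the ideals, because
   it does so on each of the two pieces of the carrier and an ideal is
   determined by its traces on these. *)
Lemma embeds_antisym {T U : Type} (I : set (set T)) (J : set (set U)) :
  set_ideal I -> set_ideal J -> I ≼ J -> J ≼ I ->
  ideal_iso [set: T] [set: U] I J.
Proof.
move=> idI idJ /embedsTP[f [finj fIJ]] /embedsTP[g [ginj gJI]].
pose O := orbit f g.
have /choice[h hP] : forall x, exists y, (O x -> y = f x) /\ (~ O x -> g y = x).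
  move=> x; have [Ox|nOx] := pselect (O x); first by exists (f x).
  have [[y _ gyx]|ngx] := pselect (range g x); first by exists y.
  by case: nOx; constructor.
have hf x : O x -> h x = f x by case: (hP x) => + _; apply.
have gh x : ~ O x -> g (h x) = x by case: (hP x) => _; apply.
exists h; split; first split=> //.
- move=> x y _ _; have [Ox|nOx] := pselect (O x); have [Oy|nOy] := pselect (O y).
  + by rewrite !hf// => /finj.
  + rewrite hf// => fxhy; have := gh _ nOy; rewrite -fxhy => yE.
    by case: nOy; rewrite -yE; constructor.
  + rewrite (hf y)// => hxfy; have := gh _ nOx; rewrite hxfy => xE.
    by case: nOx; rewrite -xE; constructor.
  + by move=> hxy; rewrite -(gh _ nOx) hxy gh.
- move=> y _; have [Ogy|nOgy] := pselect (O (g y)); last first.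
    by exists (g y) => //; apply: ginj; rewrite gh.
  (* As [g y] lies in the range of [g], only [orbit_step] can have produced it: [g y = g (f x)], and
     [x] is the preimage sought. *)
  move: {1 2}(g y) Ogy (erefl (g y)) => z Oz; case: Oz => [x ngx yx|x Ox].
    by case: ngx; exists y.
  by move=> /ginj yE; exists x => //; rewrite hf.
move=> A _; rewrite -{1}(setUIDK A O) (set_idealP idI).
have -> : h @` A = (f @` (A `&` O)) `|` (h @` (A `\` O)).
  rewrite -{1}(setUIDK A O) image_setU; congr (_ `|` _).
  by apply: eq_imagel => x [_ /hf].
rewrite (set_idealP idJ) -fIJ gJI image_comp.
suff -> : (g \o h) @` (A `\` O) = A `\` O by [].
rewrite -[RHS]image_id; apply: eq_imagel => x [_ /gh //].
Qed.

(** * Direct sums in coordinates *)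

(** Here [phi n] enumerates the piece carrying the summand [n], and [p] sends a point to the index
    of its piece and its position there. *)
Record is_sum (D : set nat) (I : nat -> set (set nat)) (S : set (set nat))
    (phi : nat -> nat -> nat) (p : nat -> nat * nat) : Prop := IsSum {
  sum_dom : forall z, D (p z).1;
  sum_pK : forall z, phi (p z).1 (p z).2 = z;
  sum_phiK : forall n x, D n -> p (phi n x) = (n, x);
  sumP : forall A, S A <-> forall n, D n -> I n (phi n @^-1` A) }.

Lemma direct_sum_is_sum D I S :
  is_direct_sum D I S -> exists phi p, is_sum D I S phi p.
Proof.
move=> [K [I' [[covK trivK _] isoK SP]]].
have /choice[phi phiP] : forall n, exists f : nat -> nat, D n ->
    set_bij [set: nat] (K n) f /\
    forall A, A `<=` setT -> (I n A <-> I' n (f @` A)).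
  move=> n; have [Dn|nDn] := pselect (D n); last by exists id.
  by have [f fP] := isoK _ Dn; exists f.
have /choice[p pP] z : exists nx : nat * nat, D nx.1 /\ phi nx.1 nx.2 = z.
  have : [set: nat] z by []; rewrite -covK => -[n Dn Knz].
  have [[_ _ fs] _] := phiP _ Dn; have [x _ xz] := fs _ Knz.
  by exists (n, x).
have Kphi n x : D n -> K n (phi n x).
  by move=> /phiP[[+ _ _] _]; apply.
exists phi, p; split=> [z|z|n x Dn|A].
- by case: (pP z).
- by case: (pP z).
- case: (p _) (pP (phi n x)) => m y /= [Dm phiE].
  have mn : m = n.
    by apply: (trivK) => //; exists (phi n x); split; [rewrite -phiE|]; exact: Kphi.
  move: phiE; rewrite mn; have [[_ finj _] _] := phiP _ Dn.
  by move=> /finj ->//; rewrite inE.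
- have key n : D n -> (I' n (A `&` K n) <-> I n (phi n @^-1` A)).
    move=> Dn; have [[ff _ fs] fI] := phiP _ Dn.
    rewrite fI//; suff -> : phi n @` (phi n @^-1` A) = A `&` K n by [].
    apply/seteqP; split=> [_ [x Ax <-]|z [Az /fs[x _ xz]]].
      by split=> //; exact: ff.
    by exists x => //=; rewrite xz.
  by rewrite SP; split=> H n Dn; have /key := H n Dn; apply.
Qed.

Section Sum.
Context {D : set nat} {I : nat -> set (set nat)} {S : set (set nat)}
  {phi : nat -> nat -> nat} {p : nat -> nat * nat}.
Hypothesis sumS : is_sum D I S phi p.

Lemma sum_inj z z' : (p z).1 = (p z').1 -> (p z).2 = (p z').2 -> z = z'.
Proof. by move=> e1 e2; rewrite -(sum_pK sumS z) e1 e2 (sum_pK sumS). Qed.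

Lemma sum_phi_inj n : D n -> injective (phi n).
Proof.
move=> Dn x y xy; have := sum_phiK sumS x Dn.
by rewrite xy (sum_phiK sumS)// => -[].
Qed.

Hypothesis idI : forall n, D n -> set_ideal (I n).

Lemma sum_ideal : set_ideal S.
Proof.
split=> [A Afin|A B AB /(sumP sumS) SB|A B /(sumP sumS) SA /(sumP sumS) SB];
  apply/(sumP sumS) => n Dn; have [If Isub IU] := idI Dn.
- by apply/If/finite_preimage => // x y _ _; exact: sum_phi_inj.
- by apply: Isub (SB n Dn) => x; exact: AB.
- by apply: IU; [exact: SA|exact: SB].
Qed.

(** Each trace has at most one point. Such selectors are the test sets that keep a member of the
    orthogonal within finitely many pieces. *)
Lemma sum_selector A : (forall z z', A z -> A z' -> (p z).1 = (p z').1 -> z = z') ->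
  S A.
Proof.
move=> Asel; apply/(sumP sumS) => n Dn; have [If _ _] := idI Dn; apply: If.
have [[x Ax]|nA] := pselect (exists x, A (phi n x)); last first.
  by rewrite (_ : _ @^-1` _ = set0)//; apply/seteqP; split=> // x Ax; apply: nA; exists x.
apply: sub_finite_set (finite_set1 x) => y Ay.
by apply: (sum_phi_inj Dn); apply: Asel => //; rewrite !(sum_phiK sumS).
Qed.

Lemma orthogonal_sumP A : orthogonal S A <->
  finite_set [set (p z).1 | z in A] /\
  forall n, D n -> orthogonal (I n) (phi n @^-1` A).
Proof.
split=> [oA|[finA oA] C /(sumP sumS) SC]; first split.
(* [g] selects a point of [A] in each piece that [A] meets. The selector is in [S], so its
   intersection with [A] is finite. *)
- have /choice[g gP] : forall n, exists z,
      (exists2 z, A z & (p z).1 = n) -> A z /\ (p z).1 = n.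
    move=> n; have [[z Az zn]|nA] := pselect (exists2 z, A z & (p z).1 = n).
      by exists z.
    by exists 0%N => /nA.
  set L := [set _ | _ in A].
  have gL n : L n -> A (g n) /\ (p (g n)).1 = n.
    by move=> [z Az zn]; apply: gP; exists z.
  have SgL : S (g @` L).
    apply: sum_selector => _ _ [m Lm <-] [n Ln <-].
    by rewrite (gL _ Lm).2 (gL _ Ln).2 => ->.
  apply: sub_finite_set (finite_image (fun z => (p z).1) (oA _ SgL)).
  move=> n Ln; exists (g n); last by case: (gL _ Ln).
  by split; [exists n|case: (gL _ Ln)].
- move=> n Dn C IC.
  (* A test set for one summand becomes a test set for the sum when placed in the piece [n]
     alone. *)
  have SC : S (phi n @` C).
    apply/(sumP sumS) => m Dm; have [->|/eqP mn] := eqVneq m n.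
      by rewrite image_preimage_inj; [|exact: sum_phi_inj].
    rewrite (_ : _ @^-1` _ = set0); first by apply: set_ideal0; exact: idI.
    apply/seteqP; split=> // x [y Cy] /(congr1 p).
    by rewrite !(sum_phiK sumS)// => -[/esym].
  have := oA _ SC => /(finite_preimage (f := phi n)).
  rewrite preimage_setI image_preimage_inj; last exact: sum_phi_inj.
  by apply=> x y _ _; exact: sum_phi_inj.
- apply: (@sub_finite_set _ _ (\bigcup_(n in [set (p z).1 | z in A])
    (phi n @` (phi n @^-1` C `&` phi n @^-1` A)))).
    move=> z [Cz Az]; exists (p z).1; first by exists z.
    by exists (p z).2; rewrite /= (sum_pK sumS).
  apply: bigcup_finite => // n [z Az <-]; apply: finite_image.
  by apply: oA; [exact: sum_dom sumS _|apply: SC; exact: sum_dom sumS _].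
Qed.

(** A set orthogonal to one summand, placed in its piece, meets a single piece and is therefore
    orthogonal to the whole sum. So a member of the double orthogonal has all its traces in the
    double orthogonals of the summands. *)
Lemma Frechet_sum : (forall n, D n -> Frechet (I n)) -> Frechet S.
Proof.
move=> FI; apply/seteqP; split; first exact: sub_orthogonal2.
move=> B ooB; apply/(sumP sumS) => n Dn; rewrite (FI _ Dn) => C oC.
have : orthogonal S (phi n @` C).
  apply/orthogonal_sumP; split=> [|m Dm].
    apply: sub_finite_set (finite_set1 n) => _ [_ [x _ <-] <-].
    by rewrite (sum_phiK sumS).
  have [->|/eqP mn] := eqVneq m n.
    by rewrite image_preimage_inj; [|exact: sum_phi_inj].
  rewrite (_ : _ @^-1` _ = set0); first by apply: set_ideal0; exact: orthogonal_ideal.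
  apply/seteqP; split=> // x [y Cy] /(congr1 p).
  by rewrite !(sum_phiK sumS)// => -[/esym].
move=> /ooB/(finite_preimage (f := phi n)).
rewrite preimage_setI image_preimage_inj; last exact: sum_phi_inj.
by apply=> x y _ _; exact: sum_phi_inj.
Qed.

End Sum.

Definition code (n x : nat) : nat := to_nat (n, x).

Lemma pairing_is_sum (I : nat -> set (set nat)) :
  is_sum [set: nat] I [set A | forall n, I n (code n @^-1` A)] code of_nat.
Proof.
split=> // [z|n x _|A]; first by rewrite /code -surjective_pairing cancel_to_of.
  by rewrite /code cancel_of_to.
by split=> [H n _|H n]; apply: H.
Qed.

Lemma is_sum_direct_sum D I S phi p :
  (forall n, D n -> set_ideal (I n)) -> is_sum D I S phi p -> is_direct_sum D I S.
Proof.
move=> idI sumS; exists (fun n => range (phi n)), (fun n => [set A | I n (phi n @^-1` A)]).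
split.
- split.
  + apply/seteqP; split=> // z _; exists (p z).1; first exact: sum_dom sumS _.
    by exists (p z).2 => //; rewrite (sum_pK sumS).
  + move=> m n Dm Dn [_ [[x _ <-] [y _ /(congr1 p)]]].
    by rewrite !(sum_phiK sumS)// => -[].
  + by move=> n Dn; exists (phi n 0); exists 0%N.
- move=> n Dn; exists (phi n); split.
    split=> [x _|x y _ _|y [x _ <-]]; [by exists x|exact: (sum_phi_inj sumS)|by exists x].
  by move=> A _ /=; rewrite image_preimage_inj//; exact: (sum_phi_inj sumS).
- move=> A; rewrite (sumP sumS).
  suff E n : phi n @^-1` (A `&` range (phi n)) = phi n @^-1` A.
    by split=> H n Dn /=; [rewrite E|rewrite -E]; exact: H.
  by apply/seteqP; split=> [x []//|x Ax]; split=> //; exists x.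
Qed.

(** * F_sigma_delta sets in the Cantor space *)

Section Fsigmadelta.
Context {T : topologicalType}.
Implicit Types A : set T.

Lemma Fsigma_Fsigmadelta A : Fsigma A -> Fsigmadelta A.
Proof. by move=> FA; exists (fun=> A) => //; rewrite bigcap_const. Qed.

Lemma closed_Fsigmadelta A : closed A -> Fsigmadelta A.
Proof. by move=> /closed_Fsigma/Fsigma_Fsigmadelta. Qed.

Lemma Fsigmadelta_bigcap (F : nat -> set T) :
  (forall n, Fsigmadelta (F n)) -> Fsigmadelta (\bigcap_n F n).
Proof.
move=> FF; have /choice[G GP] : forall n, exists G : nat -> set T,
    (forall i, Fsigma (G i)) /\ F n = \bigcap_i G i.
  by move=> n; have [G FG GE] := FF n; exists G.
exists (fun i => G (of_nat i).1 (of_nat i).2) => [i|]; first by case: (GP (of_nat i).1).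
apply/seteqP; split=> x Fx n _.
  by have := Fx (of_nat n).1 Logic.I; rewrite (GP _).2; apply.
by rewrite (GP _).2 => i _; have := Fx (to_nat (n, i)) Logic.I; rewrite cancel_of_to.
Qed.

Lemma Fsigmadelta_setI A B :
  Fsigmadelta A -> Fsigmadelta B -> Fsigmadelta (A `&` B).
Proof.
move=> FA FB; rewrite (_ : A `&` B = \bigcap_n (if n is 0 then A else B)).
  by apply: Fsigmadelta_bigcap => -[].
apply/seteqP; split=> [x [Ax Bx] [|n] _//|x ABx].
by split; [exact: ABx 0%N Logic.I|exact: ABx 1%N Logic.I].
Qed.

End Fsigmadelta.

Lemma Fsigmadelta_preimage {T U : topologicalType} (f : T -> U) (A : set U) :
  continuous f -> Fsigmadelta A -> Fsigmadelta (f @^-1` A).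
Proof.
move=> cf [F FF ->]; rewrite preimage_bigcap; exists (fun i => f @^-1` F i) => // i.
have [G cG ->] := FF i; rewrite preimage_bigcup; exists (fun j => f @^-1` G j) => // j.
by apply: preimage_closed => // x _; exact: cf.
Qed.

Lemma reindex_continuous (phi : nat -> nat) :
  continuous (fun x : cantor_space => (fun n => x (phi n)) : cantor_space).
Proof.
(* The product topology is the supremum of those induced by the coordinates, so continuity is tested
   one coordinate at a time. *)
move=> x; apply/cvg_sup => i; move: x.
apply/(@continuousP _ (initial_topology (@^~ i))) => A [B oB <-].
rewrite (_ : _ @^-1` _ = (fun x : cantor_space => x (phi i)) @^-1` B)//.
by apply: open_comp => // x _; exact: proj_continuous.
Qed.

Lemma Fsigmadelta_reindex (I : set (set nat)) (phi : nat -> nat) :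
  Fsigmadelta (char_set I) -> Fsigmadelta (char_set [set A | I (phi @^-1` A)]).
Proof. exact/Fsigmadelta_preimage/reindex_continuous. Qed.

Lemma finite_set_natP (A : set nat) :
  finite_set A <-> exists N, forall n, A n -> (n < N)%N.
Proof.
split=> [/finite_seqP[s ->]|[N AN]]; last exact: sub_finite_set AN (finite_II N).
by exists (\max_(i <- s) i).+1 => n /= ns; rewrite ltnS; exact: leq_bigmax_seq.
Qed.

(** For a fixed bound [N], containing no [z] with [N <= l z] is a closed condition. Taking for [l]
    the index of the piece handles orthogonals of sums, and the identity handles [Fin]. *)
Lemma Fsigma_bounded (l : nat -> nat) :
  Fsigma (char_set [set A | finite_set (l @` A)]).
Proof.
exists (fun N => \bigcap_(z in [set z | (N <= l z)%N]) [set x : cantor_space | x z = false]).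
  move=> N; apply: closed_bigI => z _.
  apply: (@preimage_closed _ _ (fun x : cantor_space => x z) [set false]).
    by move=> x _; exact: proj_continuous.
  exact: discrete_closed.
apply/seteqP; split=> [x /finite_set_natP[N xN]|x [N _ xN]].
  exists N => // z /= Nlz; apply/negP => xz.
  have : (l z < N)%N by apply: xN; exists z.
  by rewrite ltnNge Nlz.
apply/finite_set_natP; exists N => _ [z xz <-]; rewrite ltnNge; apply/negP => Nlz.
by have := xN z Nlz; rewrite /= in xz *; rewrite xz.
Qed.

(** * Tame ideals and induction over [calB] *)

(** The complexity is required of both ideals of an orthogonal pair. The Fréchet property makes the
    double orthogonal return to [I], so the class is stable under orthogonals. *)
Definition tame (I : set (set nat)) := [/\ set_ideal I, Frechet I,
  Fsigmadelta (char_set I) & Fsigmadelta (char_set (orthogonal I))].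

Lemma tame_sum D I S phi p : (forall n, D n -> tame (I n)) ->
  is_sum D I S phi p -> tame S.
Proof.
move=> tI sumS.
have idI n : D n -> set_ideal (I n) by case/tI.
have Fsd_pieces J : (forall n, D n -> Fsigmadelta (char_set (J n))) ->
    Fsigmadelta (char_set [set A | forall n, D n -> J n (phi n @^-1` A)]).
  move=> FJ.
  (* Outside [D] the condition is vacuous, which lets the intersection run over all of [nat]. *)
  rewrite (_ : char_set _ = \bigcap_n char_set [set A | D n -> J n (phi n @^-1` A)]).
    apply: Fsigmadelta_bigcap => n; have [Dn|nDn] := pselect (D n).
      rewrite (_ : [set A | _] = [set A | J n (phi n @^-1` A)]).
        exact/Fsigmadelta_reindex/FJ.
      by apply/seteqP; split=> A; [exact|move=> ? ?].
    rewrite (_ : char_set _ = setT); first by apply: closed_Fsigmadelta; exact: closedT.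
    by apply/seteqP; split=> // x _ /nDn.
  by apply/seteqP; split=> x H n => [_ /H|]//; exact: H n Logic.I.
split.
- exact: sum_ideal sumS idI.
- by apply: (Frechet_sum sumS) => // n /tI[].
- rewrite (_ : S = [set A | forall n, D n -> I n (phi n @^-1` A)]).
    by apply: (Fsd_pieces I) => n /tI[].
  by apply/seteqP; split=> A; have [] := sumP sumS A.
- rewrite (_ : char_set _ = char_set [set A | finite_set ((fun z => (p z).1) @` A)] `&`
    char_set [set A | forall n, D n -> orthogonal (I n) (phi n @^-1` A)]).
    apply: Fsigmadelta_setI; first exact/Fsigma_Fsigmadelta/Fsigma_bounded.
    by apply: (Fsd_pieces (fun n => orthogonal (I n))) => n /tI[].
  by apply/seteqP; split=> x; have [] := orthogonal_sumP sumS idI [set n | x n].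
Qed.

(** A copy is a direct sum with one summand. In inductions over [calB], closure under isomorphism
    thus follows from closure under sums. *)
Lemma iso_direct_sum I J : ideal_iso [set: nat] [set: nat] I J ->
  is_direct_sum [set 0%N] (fun=> I) J.
Proof.
move=> isoIJ; exists (fun=> [set: nat]), (fun=> J); split=> //.
- split; first by rewrite /cover bigcup_set1.
  + by move=> m n /= -> ->.
  + by move=> n _; exists 0%N.
- by move=> A; rewrite setIT; split=> [JA n _//|/(_ 0%N)]; apply.
Qed.

Lemma calB_min (M : set (set (set nat))) : M Fin -> M `<=` set_ideal ->
  (forall I, M I -> M (orthogonal I)) ->
  (forall D I S phi p, (forall n, D n -> M (I n)) -> is_sum D I S phi p -> M S) ->
  calB `<=` M.
Proof.
move=> MFin Mid Mo Msum; apply: smallest_sub; last by move=> _ ->.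
have Mds D I S : (forall n, D n -> M (I n)) -> is_direct_sum D I S -> M S.
  by move=> MI /direct_sum_is_sum[phi [p]]; exact: Msum.
split=> // I J MI /iso_direct_sum; exact: Mds.
Qed.

Lemma Fin_ideal {T : Type} : set_ideal (@Fin T).
Proof.
by rewrite -orthogonal_setT; exact: orthogonal_ideal.
Qed.

Lemma calB_tame : calB `<=` tame.
Proof.
apply: calB_min.
- have FFin : Fsigmadelta (char_set Fin).
    rewrite (_ : Fin = [set A | finite_set (id @` A)]).
      exact/Fsigma_Fsigmadelta/Fsigma_bounded.
    by apply/seteqP; split=> A /=; rewrite image_id.
  split=> //; first exact: Fin_ideal.
  + by rewrite /Frechet orthogonal_Fin orthogonal_setT.
  + rewrite orthogonal_Fin; apply: closed_Fsigmadelta; exact: closedT.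
- by move=> I [idI _ _ _].
- move=> I [idI FI FsI FsoI]; split=> //; first exact: orthogonal_ideal.
    exact: Frechet_orthogonal.
  by rewrite -FI.
- exact: tame_sum.
Qed.

Lemma calB_closed : closed_collection calB.
Proof.
split=> [I /calB_tame[]//|I J BI IJ M MP|I BI M MP|D I S BI DIS M MP];
  have [[Mid Miso Mo Msum] MFin] := MP.
- exact: Miso (BI _ MP) IJ.
- exact: Mo (BI _ MP).
- by apply: Msum DIS => n Dn; exact: BI n Dn _ MP.
Qed.

Lemma calB_sum D I S phi p :
  (forall n, D n -> calB (I n)) -> is_sum D I S phi p -> calB S.
Proof.
have [Bid _ _ Bsum] := calB_closed => BI sumS; apply: (Bsum D I) => //.
by apply: is_sum_direct_sum sumS => n Dn; exact: Bid (BI n Dn).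
Qed.

Lemma calB_orthogonal I : calB I -> calB (orthogonal I).
Proof. by have [_ _ + _] := calB_closed; apply. Qed.

Lemma calB_Fin : calB Fin.
Proof. by move=> M [_ MFin]; exact: MFin. Qed.

(** * Well-orders with countable initial segments *)

(** Well-orders of type at most omega_1. Uncountability is stated separately. *)
Record omega1_order {W : Type} (lt : W -> W -> Prop) : Prop := Omega1Order {
  o1_wf : well_founded lt;
  o1_total : forall x y, [\/ lt x y, x = y | lt y x];
  o1_trans : forall x y z, lt x y -> lt y z -> lt x z;
  o1_seg : forall x, countable [set y | lt y x] }.

Lemma wf_min {W : Type} (lt : W -> W -> Prop) (A : set W) : well_founded lt ->
  A !=set0 -> exists2 x, A x & forall y, lt y x -> ~ A y.
Proof.
move=> wf [x]; elim/(well_founded_ind wf): x => x IH Ax.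
have [[y yx Ay]|nA] := pselect (exists2 y, lt y x & A y); first exact: IH yx Ay.
by exists x => // y yx Ay; apply: nA; exists y.
Qed.

(** In the relation [R] given by the well-ordering principle every nonempty set has a unique
    minimum. Sets of one, two and three points give the order axioms, and the set of inaccessible
    points gives well-foundedness. *)
Lemma well_order_exists (T : eqType) : exists lt : T -> T -> Prop,
  [/\ well_founded lt, forall x y, [\/ lt x y, x = y | lt y x]
    & forall x y z, lt x y -> lt y z -> lt x z].
Proof.
have [R Rwo] := wochoice.well_ordering_principle T.
have Rmin (A : {pred T}) x : x \in A -> exists2 z, z \in A & {in A, forall y, R z y}.
  by move=> Ax; have [|z [[Az zmin] _]] := Rwo A; [exists x|exists z].
have Ranti x y : R x y -> R y x -> x = y.
  move=> xy yx.
  have Rxx z : R z z.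
    by have [_ /eqP-> ] := @Rmin (pred1 z) z (eqxx z); apply; exact: eqxx.
  have [|z [_ zuniq]] := Rwo (pred2 x y); first by exists x; rewrite inE eqxx.
  rewrite -(zuniq x) ?(zuniq y)//.
    by split=> [|t]; rewrite !inE ?eqxx ?orbT// => /orP[] /eqP ->.
  by split=> [|t]; rewrite !inE ?eqxx// => /orP[] /eqP ->.
have Rtot x y : R x y \/ R y x.
  have [|z] := @Rmin (pred2 x y) x; first by rewrite inE eqxx.
  rewrite inE => /orP[] /eqP -> zmin; [left|right];
    by apply: zmin; rewrite inE eqxx ?orbT.
exists (fun x y => ~ R y x); split.
- move=> x; apply/not_notP => nAx.
  have [|z] := @Rmin [pred x | ~~ `[< Acc (fun x y => ~ R y x) x >]] x.
    by rewrite inE; apply/asboolPn.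
  rewrite inE => /asboolPn nAz zmin; apply: nAz; constructor => y nzy.
  by apply/not_notP => nAy; apply: nzy; apply: zmin; rewrite inE; apply/asboolPn.
- move=> x y; have [yx|nyx] := pselect (R y x); last by constructor 1.
  have [xy|nxy] := pselect (R x y); last by constructor 3.
  by constructor 2; exact: Ranti.
- move=> x y z nyx nzy zx.
  have xy : R x y by case: (Rtot x y).
  have yz : R y z by case: (Rtot y z).
  have [|t] := @Rmin (pred3 x y z) x; first by rewrite inE eqxx.
  rewrite !inE => tP tmin.
  have tx : R t x by apply: tmin; rewrite !inE eqxx.
  have ty : R t y by apply: tmin; rewrite !inE eqxx orbT.
  have tz : R t z by apply: tmin; rewrite !inE eqxx !orbT.
  case/or3P: tP => /eqP tE; subst t; [|exact: nyx|exact: nzy].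
  by have xz := Ranti _ _ tz zx; apply: nzy; rewrite -xz.
Qed.

Lemma countable_image {T U : Type} (f : T -> U) (A : set T) :
  countable A -> countable (f @` A).
Proof. by apply: sub_countable; exact: card_image_le. Qed.

Lemma countable_setU {T : Type} (A B : set T) :
  countable A -> countable B -> countable (A `|` B).
Proof.
move=> cA cB; rewrite -bigcup2E; apply: bigcup_countable => // i _.
by rewrite /bigcup2; case: ifP => // _; case: ifP => // _; exact: countable0.
Qed.

Lemma uncountable_powerset : ~ countable [set: set nat].
Proof.
move=> /countable_injP[f finj].
pose D := [set n | exists2 A, f A = n & ~ A n].
have [DD|nDD] := pselect (D (f D)); last by move: (nDD); apply; exists D.
have [A fA nA] := DD; have AD : A = D by apply: finj; rewrite ?inE.
by move: nA; rewrite AD.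
Qed.

(** [W] consists of the points with countably many predecessors in a well-order of the powerset of
    [nat]. Were [W] countable, it would omit some point; the least one omitted would have all its
    predecessors in [W], and so belong to [W]. *)
Lemma omega1_exists : exists (W : Type) (lt : W -> W -> Prop),
  omega1_order lt /\ ~ countable [set: W].
Proof.
have [lt [wf tot tr]] := well_order_exists (set nat).
pose C x := countable [set y | lt y x].
exists {x | C x}, (fun x y => lt (val x) (val y)); split; first split.
- exact: wf_inverse_image.
- move=> x y; case: (tot (val x) (val y)) => [xy|/val_inj xy|yx];
    by [constructor 1|constructor 2|constructor 3].
- by move=> x y z; exact: tr.
- move=> [x /= /countable_injP[f finj]].
  apply/countable_injP; exists (f \o val) => y z; rewrite !inE => yx zx yz.
  by apply: val_inj; apply: finj => //; rewrite inE.
- move=> cW; have [x nCx xmin] : exists2 x, ~ C x & forall y, lt y x -> ~ ~ C y.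
    apply: (wf_min wf); apply/existsNP => allC; apply: uncountable_powerset.
    apply: sub_countable (subset_card_le _) (countable_image val cW) => x _.
    by exists (exist _ x (allC x)).
  apply: nCx; apply: sub_countable (subset_card_le _) (countable_image val cW).
  by move=> y yx; have Cy := contrapT (xmin y yx); exists (exist _ y Cy).
Qed.

Section Omega1.
Context {W : Type} {lt : W -> W -> Prop}.
Hypothesis o1 : omega1_order lt.

Lemma o1_enum a : exists s : nat -> W, (forall b, lt b a -> exists k, s k = b) /\
  ((exists b, lt b a) -> forall k, lt (s k) a).
Proof.
have [[b0 b0a]|na] := pselect (exists b, lt b a); last first.
  by exists (fun=> a); split=> // b ba; case: na; exists b.
have /countable_injP[f finj] := o1_seg o1 a.
have /choice[s sP] : forall k, exists b, lt b a /\
    ((exists2 b', lt b' a & f b' = k) -> f b = k).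
  move=> k; have [[b ba bk]|nb] := pselect (exists2 b', lt b' a & f b' = k).
    by exists b.
  by exists b0.
exists s; split=> [b ba|_ k]; last by case: (sP k).
exists (f b); have [sa sf] := sP (f b).
by apply: finj; rewrite ?inE//; apply: sf; exists b.
Qed.

(** The points below or equal to some [u n] form a countable union of countable sets, so they do not
    exhaust [W]. *)
Lemma o1_bound (u : nat -> W) : ~ countable [set: W] -> exists d, forall n, lt (u n) d.
Proof.
move=> ncW; have : exists d, ~ (\bigcup_n ([set y | lt y (u n)] `|` [set u n])) d.
  apply/existsNP => allW; apply: ncW.
  apply: sub_countable (subset_card_le (fun x _ => allW x)) _.
  apply: bigcup_countable => // n _.
  by apply: countable_setU; [exact: o1_seg|exact: countable1].
move=> [d nd]; exists d => n; case: (o1_total o1 (u n) d) => [//|ud|du].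
  by case: nd; exists n => //; right.
by case: nd; exists n => //; left.
Qed.

(** By transfinite recursion, [f w] is chosen in [B] different from the countably many earlier
    values. This makes omega_1 embed in every uncountable set. *)
Lemma o1_injection {U : Type} (B : set U) : ~ countable B ->
  exists f : W -> U, injective f /\ forall w, B (f w).
Proof.
move=> ncB.
have fresh (w : W) (g : forall v, lt v w -> U) :
    exists y, B y /\ forall v (vw : lt v w), g v vw <> y.
  apply/not_existsP => nf; move: (ncB); apply.
  have [y0 By0] : exists y0, B y0.
    by apply/not_existsP => nB; apply: ncB; rewrite (_ : B = set0)//; apply/seteqP; split.
  pose g' v := if pselect (lt v w) is left vw then g v vw else y0.
  apply: sub_countable (subset_card_le _) (countable_image g' (o1_seg o1 w)) => y By.
  apply/not_notP => ng; apply: (nf y); split=> // v vw gy; apply: ng; exists v => //.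
  by rewrite /g'; case: pselect => // vw'; rewrite (Prop_irrelevance vw' vw).
pose step w g := projT1 (cid (fresh w g)).
pose f := Fix (o1_wf o1) (fun=> U) step.
have fE w : f w = step w (fun v _ => f v).
  by apply: Fix_eq => x g h gh; congr step; apply/functional_extensionality_dep => v;
    apply/functional_extensionality_dep => vx.
have fP w : B (f w) /\ forall v, lt v w -> f v <> f w.
  by rewrite (fE w) /step; case: cid => y /= [By yP]; split=> // v vw; exact: yP.
exists f; split; last by move=> w; case: (fP w).
move=> v w vw; have [_ fv] := fP v; have [_ fw] := fP w.
by case: (o1_total o1 v w) => [/fw//|//|/fv[]].
Qed.

End Omega1.

(** Makes [o1_injection] available for [W * nat], which indexes the levels below, in place of an
    appeal to cardinal arithmetic. *)
Lemma o1_lex {W : Type} (lt : W -> W -> Prop) : omega1_order lt ->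
  omega1_order (Relation_Operators.slexprod W nat lt Peano.lt).
Proof.
move=> o1; split.
- exact: wf_slexprod (o1_wf o1) PeanoNat.Nat.lt_wf_0.
- move=> [x m] [y n]; case: (o1_total o1 x y) => [xy|<-|yx].
  + by constructor 1; left.
  + by case: (ltngtP m n) => [/ltP mn|/ltP nm|->];
      [constructor 1|constructor 3|constructor 2] => //; right.
  + by constructor 3; left.
- move=> _ _ [z k] [x y m n xy|x m n mn] H; inversion H; subst.
  + by left; exact: o1_trans o1 _ _ _ xy _.
  + by left.
  + by left.
  + by right; apply: PeanoNat.Nat.lt_trans mn _.
- move=> [x n]; apply: (@sub_countable _ _ _ (([set y | lt y x] `|` [set x]) `*` [set: nat])).
    by apply: subset_card_le => q qx; inversion qx; subst; split=> //=; [left|right].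
  apply: countableX; last exact: countableP.
  by apply: countable_setU; [exact: o1_seg|exact: countable1].
Qed.

(* [J] absorbs a second copy of itself: the direct sum of two copies of [J]
   embeds in [J]. *)
Definition idem {T : Type} (J : set (set T)) := exists u v : T -> T,
  [/\ injective u, injective v, forall x y, u x <> v y,
      forall A, J A <-> J (u @` A) & forall A, J A <-> J (v @` A)].

Lemma idem_orthogonal {T : Type} (J : set (set T)) :
  set_ideal J -> idem J -> idem (orthogonal J).
Proof.
move=> idJ [u [v [uinj vinj uv Ju Jv]]]; exists u, v.
by split=> //; exact: embedding_orthogonal.
Qed.

Lemma idem_biembeds {T U : Type} (I : set (set T)) (J : set (set U)) :
  I ≼ J -> J ≼ I -> idem J -> idem I.
Proof.
move=> /embedsTP[f [finj fIJ]] /embedsTP[g [ginj gJI]] [u [v [uinj vinj uv Ju Jv]]].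
exists (g \o u \o f), (g \o v \o f); split.
- by move=> x y /ginj/uinj/finj.
- by move=> x y /ginj/vinj/finj.
- by move=> x y /ginj; exact: uv.
- by move=> A; rewrite fIJ Ju gJI !image_comp.
- by move=> A; rewrite fIJ Jv gJI !image_comp.
Qed.

(** * Gluing embeddings of disjoint pieces *)

Lemma embeds_set0 {T U : Type} (u : U) (I : set (set T)) (J : set (set U)) :
  set_ideal I -> set_ideal J -> embeds set0 [set: U] I J.
Proof.
move=> idI idJ; exists (fun=> u); split=> // [x y|A]; first by rewrite inE.
by rewrite subset0 => ->; rewrite image_set0; split=> _; exact: set_ideal0.
Qed.

(** Following one map by [u] and the other by [v] makes their ranges disjoint. An ideal is
    determined by its traces on two complementary pieces. *)
Lemma embeds_glue {T U : Type} (X Y : set T) (I : set (set T)) (J : set (set U)) :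
  set_ideal I -> set_ideal J -> idem J -> (forall x, X x -> ~ Y x) ->
  embeds X [set: U] I J -> embeds Y [set: U] I J ->
  embeds (X `|` Y) [set: U] I J.
Proof.
move=> idI idJ [u [v [uinj vinj uv Ju Jv]]] XY [f [_ finj fIJ]] [g [_ ginj gIJ]].
pose h x := if pselect (X x) then u (f x) else v (g x).
have hf x : X x -> h x = u (f x) by rewrite /h; case: pselect.
have hg x : ~ X x -> h x = v (g x) by rewrite /h; case: pselect.
exists h; split=> // [x y|A AXY].
  rewrite !inE => XYx XYy; have [Xx|nXx] := pselect (X x); have [Xy|nXy] := pselect (X y).
  - by rewrite !hf// => /uinj; apply: finj; rewrite inE.
  - by rewrite hf// hg// => /uv.
  - by rewrite hg// hf// => /esym/uv.
  - rewrite !hg// => /vinj; apply: ginj; rewrite inE.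
      by case: XYx.
    by case: XYy.
rewrite -{1}(setUIDK A X) (set_idealP idI).
have -> : h @` A = (u @` (f @` (A `&` X))) `|` (v @` (g @` (A `\` X))).
  rewrite -{1}(setUIDK A X) image_setU !image_comp; congr (_ `|` _).
    by apply: eq_imagel => x [_ /hf].
  by apply: eq_imagel => x [_ /hg].
rewrite (set_idealP idJ) -Ju -Jv fIJ; last by move=> x [].
by rewrite gIJ// => x [/AXY[]].
Qed.

Lemma embeds_bounded {T U : Type} (u : U) (l : T -> nat) (N : nat)
    (I : set (set T)) (J : set (set U)) :
  set_ideal I -> set_ideal J -> idem J ->
  (forall n, (n < N)%N -> embeds [set z | l z = n] [set: U] I J) ->
  embeds [set z | (l z < N)%N] [set: U] I J.
Proof.
move=> idI idJ iJ; elim: N => [_|N IH lN].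
  by rewrite (_ : [set z | _] = set0); [exact: embeds_set0|apply/seteqP; split].
rewrite (_ : [set z | _] = [set z | (l z < N)%N] `|` [set z | l z = N]).
  apply: embeds_glue => // [z /= + zN||]; first by rewrite zN ltnn.
    by apply: IH => n nN; apply: lN; rewrite ltnS ltnW.
  exact: lN.
apply/seteqP; split=> z /=; last by case=> [/ltnW|->]; rewrite ltnS.
by rewrite ltnS leq_eqVlt => /orP[/eqP|]; [right|left].
Qed.

(** * Embeddings from and into direct sums *)

Section SumEmbeddings.
Context {D : set nat} {I : nat -> set (set nat)} {S : set (set nat)}
  {phi : nat -> nat -> nat} {p : nat -> nat * nat}.
Hypotheses (sumS : is_sum D I S phi p) (idI : forall n, D n -> set_ideal (I n)).

Lemma sum_phi_image n A : D n -> I n A <-> S (phi n @` A).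
Proof.
move=> Dn; have pinj := sum_phi_inj sumS Dn.
rewrite (sumP sumS); split=> [IA m Dm|/(_ _ Dn)]; last first.
  by rewrite image_preimage_inj.
have [->|/eqP mn] := eqVneq m n; first by rewrite image_preimage_inj.
rewrite (_ : _ @^-1` _ = set0); first by apply: set_ideal0; exact: idI.
apply/seteqP; split=> // x [y _] /(congr1 p).
by rewrite !(sum_phiK sumS)// => -[/esym].
Qed.

Lemma embeds_summand n : D n -> I n ≼ S.
Proof.
move=> Dn; apply: (embedsT (sum_phi_inj sumS Dn)) => A; exact: sum_phi_image.
Qed.

Lemma sum_piece_image n A : D n -> A `<=` [set z | (p z).1 = n] ->
  A = phi n @` (phi n @^-1` A) /\ phi n @^-1` A = [set (p z).2 | z in A].
Proof.
move=> Dn An; have pz z : A z -> phi n (p z).2 = z.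
  by move=> Az; rewrite -[in LHS](An _ Az) (sum_pK sumS).
split; apply/seteqP; split=> [z Az|_ [x Ax <-]//].
- by exists (p z).2; rewrite /= pz.
- by exists (phi n z) => //; rewrite (sum_phiK sumS).
- by rewrite /= pz.
Qed.

Lemma embeds_piece n : D n -> embeds [set z | (p z).1 = n] [set: nat] S (I n).
Proof.
move=> Dn; exists (fun z => (p z).2); split=> // [y z|A An].
  by rewrite !inE => /= yn zn; apply: (sum_inj sumS); rewrite yn.
by have [AE pA] := sum_piece_image Dn An; rewrite -pA {1}AE; apply: iff_sym; exact: sum_phi_image.
Qed.

Lemma sum_map_embeds (w : nat -> nat -> nat) : (forall n, D n -> injective (w n)) ->
  (forall n A, D n -> I n A <-> I n (w n @` A)) ->
  forall A, S A <-> S ([set phi (p z).1 (w (p z).1 (p z).2) | z in A]).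
Proof.
move=> winj wI A.
have E n : D n -> phi n @^-1` [set phi (p z).1 (w (p z).1 (p z).2) | z in A] =
    w n @` (phi n @^-1` A).
  move=> Dn; apply/seteqP; split=> [x [z Az /(congr1 p)]|_ [x Ax <-]] /=.
    rewrite !(sum_phiK sumS)//; last exact: sum_dom sumS _.
    by move=> -[<- <-]; exists (p z).2; rewrite //= (sum_pK sumS).
  by exists (phi n x) => //; rewrite (sum_phiK sumS).
by rewrite !(sumP sumS); split=> H n Dn; have := H n Dn; rewrite E// -wI.
Qed.

Lemma sum_idem : (forall n, D n -> idem (I n)) -> idem S.
Proof.
move=> iI.
have /choice[w wP] : forall n, exists w : (nat -> nat) * (nat -> nat), D n ->
    [/\ injective w.1, injective w.2, forall x y, w.1 x <> w.2 y,
      forall A, I n A <-> I n (w.1 @` A) & forall A, I n A <-> I n (w.2 @` A)].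
  move=> n; have [Dn|nDn] := pselect (D n); last by exists (id, id).
  by have [u [v uvP]] := iI n Dn; exists (u, v).
have Dp z : D (p z).1 := sum_dom sumS z.
have inj w' : (forall n, D n -> injective (w' n)) ->
    injective (fun z => phi (p z).1 (w' (p z).1 (p z).2)).
  move=> w'inj y z /(congr1 p); rewrite !(sum_phiK sumS)// => -[yz].
  by rewrite yz => /(w'inj _ (Dp z)); exact: (sum_inj sumS).
exists (fun z => phi (p z).1 ((w (p z).1).1 (p z).2)),
  (fun z => phi (p z).1 ((w (p z).1).2 (p z).2)); split.
- by apply: (inj (fun n => (w n).1)) => n /wP[].
- by apply: (inj (fun n => (w n).2)) => n /wP[].
- move=> y z /(congr1 p); rewrite !(sum_phiK sumS)// => -[->].
  by have [_ _ + _ _] := wP _ (Dp z); apply.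
- by apply: (sum_map_embeds (w := fun n => (w n).1)) => n; [|move=> A]; case/wP.
- by apply: (sum_map_embeds (w := fun n => (w n).2)) => n; [|move=> A]; case/wP.
Qed.

Lemma sum_embeds_mono {D' I' S' phi' p'} (g : nat -> nat) :
  is_sum D' I' S' phi' p' -> (forall n, D' n -> set_ideal (I' n)) ->
  (forall n, D n -> D' (g n)) ->
  (forall m n, D m -> D n -> g m = g n -> m = n) ->
  (forall n, D n -> I n ≼ I' (g n)) -> S ≼ S'.
Proof.
move=> sumS' idI' gD ginj II.
have /choice[h hP] : forall n, exists h : nat -> nat, D n ->
    injective h /\ forall A, I n A <-> I' (g n) (h @` A).
  move=> n; have [Dn|nDn] := pselect (D n); last by exists id.
  by have /embedsTP[h hP] := II n Dn; exists h.
have Dp z : D (p z).1 := sum_dom sumS z.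
pose f z := phi' (g (p z).1) (h (p z).1 (p z).2).
have p'f z : p' (f z) = (g (p z).1, h (p z).1 (p z).2).
  by rewrite (sum_phiK sumS')//; exact: gD.
apply: (@embedsT _ _ _ _ f) => [y z /(congr1 p')|A].
  rewrite !p'f => -[/(ginj _ _ (Dp y) (Dp z)) yz]; rewrite yz.
  by have [hinj _] := hP _ (Dp z) => /hinj; exact: (sum_inj sumS).
have fA n : D n -> phi' (g n) @^-1` (f @` A) = h n @` (phi n @^-1` A).
  move=> Dn; apply/seteqP; split=> [x [z Az]|_ [x Ax <-]] /=.
    move=> /(congr1 p'); rewrite p'f (sum_phiK sumS'); last exact: gD.
    move=> -[/(ginj _ _ (Dp z) Dn) <- <-]; exists (p z).2 => //=.
    by rewrite (sum_pK sumS).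
  by exists (phi n x) => //; rewrite /f (sum_phiK sumS).
rewrite (sumP sumS) (sumP sumS'); split=> H n Dn; last first.
  by apply/(hP n Dn).2; rewrite -fA//; apply: H; exact: gD.
have [[m Dm gm]|nD] := pselect (exists2 m, D m & g m = n).
  by rewrite -gm fA//; apply/(hP m Dm).2; exact: H.
rewrite (_ : _ @^-1` _ = set0); first by apply: set_ideal0; exact: idI'.
apply/seteqP; split=> // x [z Az] /(congr1 p').
by rewrite p'f (sum_phiK sumS')// => -[gz _]; apply: nD; exists (p z).1.
Qed.

End SumEmbeddings.

Lemma code_inj n x m y : code n x = code m y -> n = m /\ x = y.
Proof. by move=> /(congr1 of_nat); rewrite /code !cancel_of_to => -[]. Qed.

Lemma codeK n x : of_nat (code n x) = (n, x).
Proof. exact: cancel_of_to. Qed.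

Lemma of_natK z : code (of_nat z).1 (of_nat z).2 = z.
Proof. by rewrite /code -surjective_pairing cancel_to_of. Qed.

(** Choosing each value above the previous one makes [g] strictly increasing. Used to give every
    column of a [hier d] a summand of its own. *)
Lemma injective_selector (N : nat -> set nat) : (forall c, infinite_set (N c)) ->
  exists2 g : nat -> nat, injective g & forall c, N c (g c).
Proof.
move=> Ninf.
have /choice[next nextP] : forall cm : nat * nat, exists n, N cm.1 n /\ (cm.2 < n)%N.
  move=> [c m]; apply/not_existsP => nn; apply: (Ninf c).
  apply/finite_set_natP; exists m.+1 => n Nn; rewrite ltnS leqNgt; apply/negP => mn.
  by apply: (nn n).
pose g := fix g c := if c is c'.+1 then next (c, g c') else next (0%N, 0%N).
have gS c : (g c < g c.+1)%N by have [] := nextP (c.+1, g c).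
exists g; last by case=> [|c]; [have [] := nextP (0%N, 0%N)|have [] := nextP (c.+1, g c)].
have gmono : {homo g : m n / (m < n)%N} by apply: homo_ltn => //; exact: ltn_trans.
by move=> m n gmn; case: (ltngtP m n) => // /gmono; rewrite gmn ltnn.
Qed.

(** * The hierarchy indexed by countable ordinals *)

Section Hierarchy.
Context {W : Type} {lt : W -> W -> Prop}.
Hypothesis o1 : omega1_order lt.
Variable s : W -> nat -> W.
Hypothesis s_surj : forall a b, lt b a -> exists k, s a k = b.
Hypothesis s_lt : forall a, (exists b, lt b a) -> forall k, lt (s a k) a.

(** The column [code k j] carries the copy number [j] of the summand attached to [s a k]. *)
Definition hier_step (a : W) (rec : forall b, lt b a -> set (set nat)) : set (set nat) :=
  [set A | forall k j (sa : lt (s a k) a),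
    orthogonal (rec (s a k) sa) (code (code k j) @^-1` A)].

(* [hier a] is the direct sum of the ideals [orthogonal (hier b)] with [lt b a],
   each repeated infinitely often. When [a] is minimal the condition is vacuous
   and [hier a] is the full powerset. *)
Definition hier : W -> set (set nat) :=
  Fix (o1_wf o1) (fun=> set (set nat)) hier_step.

Notation Q := hier.
Definition hier_dual a := orthogonal (Q a).
Notation P := hier_dual.

Lemma hierE a : Q a = [set A | forall k j, lt (s a k) a ->
  P (s a k) (code (code k j) @^-1` A)].
Proof.
rewrite /hier Fix_eq// => x f g fg; congr hier_step.
by apply/functional_extensionality_dep => b; apply/functional_extensionality_dep.
Qed.

(** The guard turns every summand into the powerset when [a] is minimal, so that [Q a] is a direct
    sum over [nat] in all cases. *)
Definition hier_summand a n : set (set nat) :=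
  [set A | lt (s a (of_nat n).1) a -> P (s a (of_nat n).1) A].

Lemma hier_sum a : is_sum [set: nat] (hier_summand a) (Q a) code of_nat.
Proof.
rewrite (_ : Q a = [set A | forall n, hier_summand a n (code n @^-1` A)]).
  exact: pairing_is_sum.
rewrite hierE; apply/seteqP; split=> A H => [n|k j] sa.
  have := H (of_nat n).1 (of_nat n).2 sa.
  by rewrite of_natK.
by have := H (code k j); rewrite /hier_summand /= codeK; apply.
Qed.

Lemma hier_summandE a n :
  lt (s a (of_nat n).1) a -> hier_summand a n = P (s a (of_nat n).1).
Proof. by move=> sa; apply/seteqP; split=> A => [/(_ sa)|? _]. Qed.

Lemma hier_dual_ideal a : set_ideal (P a).
Proof. exact: orthogonal_ideal. Qed.

Lemma hier_summand_ideal a n : set_ideal (hier_summand a n).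
Proof.
have [Pf Psub PU] := hier_dual_ideal (s a (of_nat n).1).
split=> [A Af _|A B AB HB sa|A B HA HB sa]; first exact: Pf.
  exact: Psub AB (HB sa).
by apply: PU; [exact: HA|exact: HB].
Qed.

Lemma hier_ideal a : set_ideal (Q a).
Proof. by apply: (sum_ideal (hier_sum a)) => n _; exact: hier_summand_ideal. Qed.

Lemma hier_calB a : calB (Q a).
Proof.
elim/(well_founded_ind (o1_wf o1)): a => a IH.
apply: (calB_sum _ (hier_sum a)) => n _.
have [sa|nsa] := pselect (lt (s a (of_nat n).1) a).
  by rewrite hier_summandE//; apply: calB_orthogonal; exact: IH.
rewrite (_ : hier_summand a n = orthogonal Fin).
  by apply: calB_orthogonal; exact: calB_Fin.
by rewrite orthogonal_Fin; apply/seteqP; split=> // A _ /nsa.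
Qed.

Lemma hier_dual_calB a : calB (P a).
Proof. by apply: calB_orthogonal; exact: hier_calB. Qed.

Lemma orthogonal_hier_dual a : orthogonal (P a) = Q a.
Proof. by have [_ FQ _ _] := calB_tame (hier_calB a); rewrite [RHS]FQ. Qed.

(* The columns of [hier a] listing a given summand are indexed by [nat]; [place n]
   maps [hier a] into the columns whose index has first component [n]. *)
Definition place (n y : nat) : nat :=
  let: (m, x) := of_nat y in code (code (of_nat m).1 (code n (of_nat m).2)) x.

Lemma placeE n k j x :
  place n (code (code k j) x) = code (code k (code n j)) x.
Proof. by rewrite /place !codeK. Qed.

Lemma place_inj n m y z : place n y = place m z -> n = m /\ y = z.
Proof.
rewrite -(of_natK y) -(of_natK z) -(of_natK (of_nat y).1) -(of_natK (of_nat z).1).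
by rewrite !placeE => /code_inj[/code_inj[-> /code_inj[-> ->]] ->].
Qed.

(** [Q a] is a direct sum of infinitely many copies of itself: splitting the copy number by [code]
    leaves every summand infinitely many columns in each part. *)
Lemma hier_place a (A : nat -> set nat) :
  Q a (\bigcup_n (place n @` A n)) <-> forall n, Q a (A n).
Proof.
have E k n j : code (code k (code n j)) @^-1` (\bigcup_n (place n @` A n)) =
    code (code k j) @^-1` A n.
  apply/seteqP; split=> x /=; last first.
    by move=> Ax; exists n => //; exists (code (code k j) x) => //; rewrite placeE.
  move=> [m _ [y Ay]]; rewrite -placeE => /place_inj[mn yE].
  by rewrite -mn -yE.
rewrite hierE; split=> [H n k j sa|H k nj sa]; first by rewrite -E; exact: H.
by rewrite -(of_natK nj) E; exact: H.
Qed.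

Lemma hier_idem a : idem (Q a).
Proof.
have placeQ n A : Q a A <-> Q a (place n @` A).
  have -> : place n @` A = \bigcup_m (place m @` (if m == n then A else set0)).
    apply/seteqP; split=> [z [y Ay <-]|z [m _ [y]]].
      by exists n => //; exists y => //; rewrite eqxx.
    by case: eqP => // -> Ay <-; exists y.
  rewrite hier_place; split=> [QA m|/(_ n)]; last by rewrite eqxx.
  by case: eqP => // _; apply: set_ideal0; exact: hier_ideal.
exists (place 0), (place 1); split=> // [x y /place_inj[]//|x y /place_inj[]//|x y /place_inj[]//].
Qed.

Lemma hier_dual_idem a : idem (P a).
Proof. by apply: idem_orthogonal; [exact: hier_ideal|exact: hier_idem]. Qed.

(** The summand [n] goes into the copy number [n] of [Q d] inside [Q d]. The set [D1] serves to
    leave out finitely many exceptional summands. *)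
Lemma sum_embeds_hier D I S phi p (D1 : set nat) d : is_sum D I S phi p ->
  (forall n, D n -> set_ideal (I n)) ->
  (forall n, D n -> D1 n -> I n ≼ Q d) ->
  embeds [set z | D1 (p z).1] [set: nat] S (Q d).
Proof.
move=> sumS idI IQ.
have /choice[h hP] : forall n, exists h : nat -> nat, D n -> D1 n ->
    injective h /\ forall A, I n A <-> Q d (h @` A).
  move=> n; have [[Dn D1n]|nDn] := pselect (D n /\ D1 n).
    by have /embedsTP[h hP] := IQ n Dn D1n; exists h.
  by exists id => Dn D1n; case: nDn.
have Dp z : D (p z).1 := sum_dom sumS z.
exists (fun z => place (p z).1 (h (p z).1 (p z).2)); split=> //.
  move=> y z; rewrite !inE => /= D1y D1z /place_inj[yz].
  rewrite yz; have [hinj _] := hP _ (Dp z) D1z => /hinj.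
  exact: (sum_inj sumS).
move=> A AD1.
have -> : [set place (p z).1 (h (p z).1 (p z).2) | z in A] =
    \bigcup_n (place n @` [set y | exists2 z, A z & (p z).1 = n /\ h n (p z).2 = y]).
  apply/seteqP; split=> [_ [z Az <-]|_ [n _ [y [z Az [pn <-]] <-]]].
    by exists (p z).1 => //; exists (h (p z).1 (p z).2) => //; exists z.
  by exists z => //; rewrite pn.
have E n : D n -> [set y | exists2 z, A z & (p z).1 = n /\ h n (p z).2 = y] =
    h n @` (phi n @^-1` A).
  move=> Dn; apply/seteqP; split=> [_ [z Az [<- <-]]|_ [x Ax <-]].
    by exists (p z).2 => //=; rewrite (sum_pK sumS).
  by exists (phi n x) => //; rewrite (sum_phiK sumS).
rewrite hier_place (sumP sumS); split=> H n => [|Dn].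
  have [[Dn D1n]|nDn] := pselect (D n /\ D1 n).
    by rewrite E//; apply/(hP n Dn D1n).2; exact: H.
  rewrite (_ : [set y | _] = set0); first by apply: set_ideal0; exact: hier_ideal.
  by apply/seteqP; split=> // y [z Az [pn _]]; apply: nDn; rewrite -pn; split=> //; exact: AD1.
have [D1n|nD1n] := pselect (D1 n).
  by apply/(hP n Dn D1n).2; rewrite -E.
rewrite (_ : _ @^-1` _ = set0); first by apply: set_ideal0; exact: idI.
apply/seteqP; split=> // x /AD1; rewrite /= (sum_phiK sumS)//.
Qed.

(** Each [P b] is available in infinitely many summands, so the columns of [Q d] can be sent into
    distinct summands. *)
Lemma hier_embeds_sum D I S phi p d : is_sum D I S phi p ->
  (forall n, D n -> set_ideal (I n)) -> infinite_set D ->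
  (forall b, lt b d -> infinite_set [set n | D n /\ P b ≼ I n]) -> Q d ≼ S.
Proof.
move=> sumS idI Dinf PI.
have [d_gt|d_min] := pselect (exists b, lt b d); last first.
  (* For minimal [d], [Q d] is the powerset, and one point in each of infinitely many pieces carries
     a copy of it. *)
  have [g ginj Dg] := injective_selector (fun=> Dinf).
  apply: (@embedsT _ _ _ _ (fun n => phi (g n) 0)) => [m n /(congr1 p)|A].
    by rewrite !(sum_phiK sumS)// => -[/ginj].
  split=> [_|_]; last first.
    by rewrite hierE => k j sa; case: d_min; exists (s d k).
  apply: (sum_selector sumS idI) => _ _ [m _ <-] [n _ <-].
  by rewrite !(sum_phiK sumS)//= => ->.
have [g ginj gP] := injective_selector (fun c => PI _ (s_lt d_gt (of_nat c).1)).
apply: (sum_embeds_mono (g := g) (hier_sum d) sumS) => // [n _|m n _ _ /ginj//|n _].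
  by case: (gP n).
by rewrite hier_summandE; [case: (gP n)|exact: s_lt].
Qed.

(** * Comparison of the members of the hierarchy *)

Lemma hier_dual_embeds b a : lt b a -> P b ≼ Q a.
Proof.
move=> ba; have [k sk] := s_surj ba.
have sa : lt (s a (of_nat (code k 0)).1) a by rewrite codeK /= sk.
have := embeds_summand (hier_sum a) (fun n _ => hier_summand_ideal a n)
  (n := code k 0) Logic.I.
by rewrite hier_summandE// codeK /= sk.
Qed.

(** A [c] below [b] is also below [a], so [P c] fills infinitely many columns of [Q a]. *)
Lemma hier_embeds b a : lt b a -> Q b ≼ Q a.
Proof.
move=> ba; apply: (hier_embeds_sum (hier_sum a)).
- by move=> n _; exact: hier_summand_ideal.
- exact: infinite_nat.
- move=> c cb; have ca := o1_trans o1 cb ba; have [k sk] := s_surj ca.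
  have kinj : injective (code k) by move=> m n /code_inj[].
  apply: (@sub_infinite_set _ (range (code k))) => [_ [j _ <-]|].
    split=> //; rewrite hier_summandE codeK /= sk //; exact: embeds_refl.
  by move=> /(finite_preimage (f := code k)); rewrite image_preimage_inj// => fin;
    apply: infinite_nat; apply: fin => x y _ _ /kinj.
Qed.

Lemma hier_embeds_dual b a : lt b a -> Q b ≼ P a.
Proof.
move=> ba; rewrite -orthogonal_hier_dual.
by apply: embeds_orthogonal; [exact: hier_ideal|exact: hier_dual_embeds].
Qed.

Lemma hier_dual_embeds_dual b a : lt b a -> P b ≼ P a.
Proof.
by move=> ba; apply: embeds_orthogonal; [exact: hier_ideal|exact: hier_embeds].
Qed.

Lemma hier_max a N : exists k, forall m, (m < N)%N ->
  s a m = s a k \/ lt (s a m) (s a k).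
Proof.
elim: N => [|N [k kN]]; first by exists 0%N.
have [lek|gtk] := pselect (s a N = s a k \/ lt (s a N) (s a k)).
  by exists k => m; rewrite ltnS leq_eqVlt => /orP[/eqP ->//|/kN].
exists N => m; rewrite ltnS leq_eqVlt => /orP[/eqP ->|/kN mk]; first by left.
case: (o1_total o1 (s a N) (s a k)) => [lk|ek|kl].
- by case: gtk; right.
- by case: gtk; left.
- by right; case: mk => [->//|mk]; move: (o1_trans o1 mk kl).
Qed.

Lemma not_hier_embeds_hier_dual a : ~ (Q a ≼ P a).
Proof.
elim/(well_founded_ind (o1_wf o1)): a => a IH /embedsTP[f [finj fP]].
have sumQ := hier_sum a.
have idR n : [set: nat] n -> set_ideal (hier_summand a n) by move=> _; exact: hier_summand_ideal.
have [a_gt|a_min] := pselect (exists b, lt b a); last first.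
  (* In the minimal case [nat] itself is in [Q a], so its image under [f] would be orthogonal to the
     powerset, hence finite. *)
  have QT A : Q a A by rewrite hierE => k j sa; case: a_min; exists (s a k).
  have /fP/(_ _ (QT setT)) := QT setT; rewrite setTI => /(finite_preimage (f := f)).
  rewrite image_preimage_inj// => fin; apply: infinite_nat; apply: fin.
  by move=> x y _ _ /finj.
(* Otherwise choose [g N] in a column from [N] on with its image also in such a column. Both
   [range g] and its image have finite traces on columns, so both are in [Q a]. The image is also in
   [P a], hence finite, yet it meets columns of arbitrarily large index. *)
have [N PN] : exists N, forall z, (N <= (of_nat z).1)%N -> ((of_nat (f z)).1 < N)%N.
  apply/not_existsP => nN.
  have /choice[g gP] : forall N, exists z, (N <= (of_nat z).1)%N /\ (N <= (of_nat (f z)).1)%N.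
    move=> N; apply/not_existsP => nz; apply: (nN N) => z zN; rewrite ltnNge.
    by apply/negP => fzN; apply: (nz z).
  have QA (h : nat -> nat) : (forall N, N <= (of_nat (h N)).1)%N -> Q a (range h).
    move=> hN; apply/(sumP sumQ) => n _; have [If _ _] := idR n Logic.I; apply: If.
    have := finite_image h (finite_II n.+1).
    move=> /(finite_preimage (f := code n)) fin.
    apply: sub_finite_set (fin _) => [x [N _ hNx]|x y _ _ /code_inj[]//].
    by exists N => //=; rewrite ltnS; have := hN N; rewrite hNx codeK.
  have Qg : Q a (range g) by apply: QA => N; case: (gP N).
  have Qfg : Q a (range (f \o g)) by apply: QA => N; case: (gP N).
  have /fP/(_ _ Qfg) := Qg; rewrite image_comp setIid.
  move=> /(finite_image (fun z => (of_nat z).1))/finite_set_natP[M ltM].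
  have := ltM (of_nat (f (g M))).1; have [_ + /(_ _)] := gP M.
  by rewrite leqNgt => /negP + H; apply; apply: H; exists (f (g M)) => //; exists M.
have [k kmax] := hier_max a N.
have saP n : lt (s a n) a by exact: s_lt.
pose b := s a k; apply: (IH b (saP k)).
have PbQb : embeds [set: nat] [set z | ((of_nat z).1 < N)%N] (P b) (P a).
  (* The column [code k N] is a copy of [P b] whose index is large enough for [f] to send it into
     the first [N] columns. *)
  have kN : (N <= code k N)%N.
    have := Cantor.to_nat_non_decreasing k N; rewrite /code => /leP.
    by apply: leq_trans; exact: leq_addr.
  exists (fun x => f (code (code k N) x)); split.
  - by move=> x _ /=; apply: PN; rewrite codeK.
  - by move=> x y _ _ /finj/code_inj[].
  - move=> A _; have := sum_phi_image sumQ idR (n := code k N) A Logic.I.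
    by rewrite hier_summandE codeK//= => ->; rewrite fP image_comp.
(* Together with the embedding just found this gives [P b ≼ Q b], and by orthogonality [Q b ≼ P b],
   against the induction hypothesis. *)
suff : embeds [set z | ((of_nat z).1 < N)%N] [set: nat] (P a) (Q b).
  move=> /(embeds_trans PbQb)/(embeds_orthogonal (hier_ideal b)).
  by rewrite orthogonal_hier_dual.
apply: embeds_bounded => //; [exact: hier_dual_ideal|exact: hier_ideal|exact: hier_idem|].
move=> n nN.
(* Orthogonality turns the column [n] of [Q a] into a copy of [Q (s a (of_nat n).1)]. Since
   [(of_nat n).1 <= n < N], this level is at most [b]. *)
have pieceQ : embeds [set z | (of_nat z).1 = n] [set: nat] (P a) (Q (s a (of_nat n).1)).
  exists (fun z => (of_nat z).2); split=> // [y z|A An].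
    by rewrite !inE => /= yn zn; apply: (sum_inj sumQ); rewrite yn.
  have [AE pA] := sum_piece_image sumQ Logic.I An.
  rewrite -pA [P a]/hier_dual (orthogonal_sumP sumQ idR); split=> [[_ /(_ n Logic.I)]|QA].
    by rewrite hier_summandE// orthogonal_hier_dual.
  split=> [|m _].
    by apply: sub_finite_set (finite_set1 n) => _ [z /An <- <-].
  have [->|/eqP mn] := eqVneq m n.
    by rewrite hier_summandE// orthogonal_hier_dual.
  rewrite (_ : _ @^-1` _ = set0); first by apply: set_ideal0; exact: orthogonal_ideal.
  by apply/seteqP; split=> // x /An; rewrite /= codeK.
apply: embeds_trans pieceQ _.
have n1N : ((of_nat n).1 < N)%N.
  apply: leq_ltn_trans nN; rewrite -[leqRHS]of_natK.
  have := Cantor.to_nat_non_decreasing (of_nat n).1 (of_nat n).2; rewrite /code => /leP.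
  by apply: leq_trans; exact: leq_addl.
by case: (kmax _ n1N) => [->|/hier_embeds//]; exact: embeds_refl.
Qed.

(** * Levels and their joins *)

Definition pair_family (I J : set (set nat)) n := if n is 0%N then I else J.

(** [I] on the even numbers and [J] on the odd ones. *)
Definition bsum (I J : set (set nat)) : set (set nat) :=
  [set A | forall n, (n < 2)%N -> pair_family I J n ((fun x => n + x.*2)%N @^-1` A)].

Lemma bsum_is_sum I J : is_sum [set n | (n < 2)%N] (pair_family I J) (bsum I J)
  (fun n x => n + x.*2)%N (fun z => (odd z : nat, z./2)).
Proof.
split=> //= [z|z|n x n2]; first by case: odd.
  exact: odd_double_half.
by case: n n2 => [|[|//]] _; rewrite ?add0n ?add1n /= ?odd_double ?doubleK ?uphalf_double.
Qed.

Lemma pair_family_ideal I J n :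
  set_ideal I -> set_ideal J -> set_ideal (pair_family I J n).
Proof. by case: n. Qed.

(** Three ideals for each [a]; all [t] from 2 on repeat the sum, which makes [W * nat] an index
    set. *)
Definition level (a : W) (t : nat) : set (set nat) :=
  match t with 0%N => P a | 1%N => Q a | _ => bsum (P a) (Q a) end.

Lemma level_ideal a t : set_ideal (level a t).
Proof.
case: t => [|[|t]] /=; [exact: hier_dual_ideal|exact: hier_ideal|].
apply: (sum_ideal (bsum_is_sum _ _)) => n _.
by apply: pair_family_ideal; [exact: hier_dual_ideal|exact: hier_ideal].
Qed.

Lemma level_idem a t : idem (level a t).
Proof.
case: t => [|[|t]] /=; [exact: hier_dual_idem|exact: hier_idem|].
apply: (sum_idem (bsum_is_sum _ _)) => -[|n] _ /=.
  exact: hier_dual_idem.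
exact: hier_idem.
Qed.

Lemma hier_dual_embeds_level2 a : P a ≼ level a 2.
Proof.
apply: (embeds_summand (bsum_is_sum (P a) (Q a)) _ (n := 0)) => // n _.
by apply: pair_family_ideal; [exact: hier_dual_ideal|exact: hier_ideal].
Qed.

Lemma hier_embeds_level2 a : Q a ≼ level a 2.
Proof.
apply: (embeds_summand (bsum_is_sum (P a) (Q a)) _ (n := 1)) => // n _.
by apply: pair_family_ideal; [exact: hier_dual_ideal|exact: hier_ideal].
Qed.

Lemma sum_embeds_bounded D I S phi p N (J : set (set nat)) : is_sum D I S phi p ->
  (forall n, D n -> set_ideal (I n)) -> set_ideal J -> idem J ->
  (forall n, D n -> (n < N)%N -> I n ≼ J) ->
  embeds [set z | ((p z).1 < N)%N] [set: nat] S J.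
Proof.
move=> sumS idI idJ iJ IJ; have idS := sum_ideal sumS idI.
apply: embeds_bounded => // n nN; have [Dn|nDn] := pselect (D n).
  by apply: embeds_trans (IJ n Dn nN); exact: (embeds_piece sumS).
rewrite (_ : [set z | _] = set0); first exact: embeds_set0.
by apply/seteqP; split=> // z /= zn; apply: nDn; rewrite -zn; exact: sum_dom sumS z.
Qed.

Lemma level2_embeds a (J : set (set nat)) : set_ideal J -> idem J ->
  P a ≼ J -> Q a ≼ J -> level a 2 ≼ J.
Proof.
move=> idJ iJ PJ QJ.
have := @sum_embeds_bounded _ _ _ _ _ 2 J (bsum_is_sum (P a) (Q a)) _ idJ iJ.
have -> : [set z : nat | ((odd z, z./2).1 < 2)%N] = setT.
  by apply/seteqP; split=> z // _ /=; case: (odd z).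
apply=> [n _|[|n] _ _ //].
by apply: pair_family_ideal; [exact: hier_dual_ideal|exact: hier_ideal].
Qed.

Lemma level_embeds_lt a t b r : lt a b -> level a t ≼ level b r.
Proof.
move=> ab.
have aP : level a t ≼ P b.
  case: t => [|[|t]]; [exact: hier_dual_embeds_dual|exact: hier_embeds_dual|].
  apply: level2_embeds; [exact: hier_dual_ideal|exact: hier_dual_idem| |].
    exact: hier_dual_embeds_dual.
  exact: hier_embeds_dual.
case: r => [//|[|r]]; last exact: embeds_trans aP (hier_dual_embeds_level2 b).
case: t {aP} => [|[|t]]; [exact: hier_dual_embeds|exact: hier_embeds|].
apply: level2_embeds; [exact: hier_ideal|exact: hier_idem| |].
  exact: hier_dual_embeds.
exact: hier_embeds.
Qed.

(** A summand too large for [Q b] can thus host a column [P b] of a higher [Q d]. *)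
Lemma level_dichotomy a t b : level a t ≼ Q b \/ P b ≼ level a t.
Proof.
case: (o1_total o1 a b) => [ab|<-|ba].
- by left; exact: (@level_embeds_lt _ _ _ 1).
- case: t => [|[|t]]; [right|left|right].
  + exact: embeds_refl.
  + exact: embeds_refl.
  + exact: hier_dual_embeds_level2.
- by right; exact: (@level_embeds_lt _ 0).
Qed.

Definition biembeds (I J : set (set nat)) := I ≼ J /\ J ≼ I.

(** A least upper bound among idempotent ideals: the higher level absorbs the lower one, and at the
    same level [P a] and [Q a] join in their sum. *)
Lemma level_join a t b r : exists c q, [/\ level a t ≼ level c q, level b r ≼ level c q
  & forall J : set (set nat), set_ideal J -> idem J ->
      level a t ≼ J -> level b r ≼ J -> level c q ≼ J].
Proof.
case: (o1_total o1 a b) => [ab|<-|ba].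
- exists b, r; split=> //; [exact: level_embeds_lt|exact: embeds_refl].
- have two t' : level a t' ≼ level a 2.
    case: t' => [|[|t']]; [exact: hier_dual_embeds_level2| |exact: embeds_refl].
    exact: hier_embeds_level2.
  case: t => [|[|t]].
  + case: r => [|[|r]].
    * by exists a, 0%N; split=> //; exact: embeds_refl.
    * by exists a, 2%N; split=> //; exact: level2_embeds.
    * by exists a, 2%N; split.
  + case: r => [|[|r]].
    * by exists a, 2%N; split=> // J idJ iJ ? ?; exact: level2_embeds.
    * by exists a, 1%N; split=> //; exact: embeds_refl.
    * by exists a, 2%N; split.
  + by exists a, 2%N; split=> //; exact: (two r).
- exists a, t; split=> //; [exact: embeds_refl|exact: level_embeds_lt].
Qed.

(** The extra term [level a t] is equivalent to a summand when the sum is finite. Otherwise it is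
    the [Q d] that absorbs all but finitely many summands. *)
Lemma level_finite_join (D : set nat) (I : nat -> set (set nat)) a t N :
  (forall n, D n -> exists b r, biembeds (I n) (level b r)) ->
  exists c q, [/\ level a t ≼ level c q,
    forall n, D n -> (n < N)%N -> I n ≼ level c q
    & forall J : set (set nat), set_ideal J -> idem J -> level a t ≼ J ->
      (forall n, D n -> (n < N)%N -> I n ≼ J) -> level c q ≼ J].
Proof.
move=> DI; elim: N => [|N [c [q [ac Ic cmin]]]].
  by exists a, t; split=> //; exact: embeds_refl.
have [DN|nDN] := pselect (D N); last first.
  exists c, q; split=> // [n Dn|J idJ iJ aJ IJ].
    by rewrite ltnS leq_eqVlt => /orP[/eqP nN|]; [case: nDN; rewrite -nN|exact: Ic].
  by apply: cmin => // n Dn nN; apply: IJ => //; exact: ltnW.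
have [b [r [IN NI]]] := DI N DN; have [d [e [cd bd dmin]]] := level_join c q b r.
exists d, e; split=> [|n Dn|J idJ iJ aJ IJ].
- exact: embeds_trans ac cd.
- rewrite ltnS leq_eqVlt => /orP[/eqP ->|nN]; first exact: embeds_trans IN bd.
  by apply: embeds_trans cd; exact: Ic.
- apply: dmin => //; last by apply: embeds_trans NI _; exact: IJ.
  by apply: cmin => // n Dn nN; apply: IJ => //; exact: ltnW.
Qed.

(** * Reduction of every member of [calB] to a level *)

Hypothesis W_uncountable : ~ countable [set: W].

Lemma sum_level D I S phi p : is_sum D I S phi p ->
  (forall n, D n -> set_ideal (I n)) ->
  (forall n, D n -> exists a t, biembeds (I n) (level a t)) ->
  exists a t, biembeds S (level a t).
Proof.
move=> sumS idI DI; have idS := sum_ideal sumS idI.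
have idemS : idem S.
  apply: (sum_idem sumS) => // n /DI[a [t [It tI]]].
  exact: idem_biembeds It tI (level_idem a t).
have IS n : D n -> I n ≼ S by exact: embeds_summand sumS idI _.
have [Dfin|Dinf] := pselect (finite_set D).
  have /finite_set_natP[N DN] := Dfin.
  have D0 := sum_dom sumS 0; have [a [t [_ aI]]] := DI _ D0.
  have [c [q [_ Ic cmin]]] := @level_finite_join D I a t N DI.
  exists c, q; split; last first.
    by apply: cmin => // [|n Dn _]; [exact: embeds_trans aI (IS _ D0)|exact: IS].
  have := sum_embeds_bounded sumS idI (level_ideal c q) (level_idem c q) Ic.
  by apply: sub_embeds => // z _; apply: DN; exact: sum_dom sumS z.
(* Candidates exist because the levels of countably many summands have a common strict upper
   bound. *)
have [d dfin dmin] : exists2 d, finite_set [set n | D n /\ ~ (I n ≼ Q d)] &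
    forall b, lt b d -> ~ finite_set [set n | D n /\ ~ (I n ≼ Q b)].
  apply: (wf_min (o1_wf o1)).
  have /choice[u uP] : forall n, exists a, D n -> exists t, biembeds (I n) (level a t).
    move=> n; have [/DI[a aP]|nDn] := pselect (D n); first by exists a.
    by have [a _] := DI _ (sum_dom sumS 0); exists a.
  have [d ud] := o1_bound o1 u W_uncountable.
  exists d; rewrite /= (_ : [set n | _] = set0)//; apply/seteqP; split=> // n [Dn]; apply.
  have [t [It _]] := uP n Dn; apply: embeds_trans It _.
  exact: (@level_embeds_lt _ _ _ 1).
have /finite_set_natP[N dN] := dfin.
have [c [q [dc Ic cmin]]] := @level_finite_join D I d 1 N DI.
exists c, q; split.
- suff : embeds ([set z | ((p z).1 < N)%N] `|` [set z | (N <= (p z).1)%N])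
      [set: nat] S (level c q).
    by apply: sub_embeds => // z _; case: (ltnP (p z).1 N); [left|right].
  apply: embeds_glue => //.
  + exact: level_ideal.
  + exact: level_idem.
  + by move=> z /=; rewrite ltnNge => /negP.
  + exact: sum_embeds_bounded sumS idI (level_ideal c q) (level_idem c q) Ic.
  + apply: embeds_trans dc.
    apply: (@sum_embeds_hier _ _ _ _ _ [set n | (N <= n)%N] _ sumS) => //.
    move=> n Dn /= Nn; apply: contrapT => nI.
    by have := dN n (conj Dn nI); rewrite ltnNge Nn.
- apply: cmin => // [|n Dn _]; last exact: IS.
  (* By minimality of [d], infinitely many summands fail to embed in [Q b] for each [b] below [d];
     by the dichotomy they contain [P b]. *)
  apply: (hier_embeds_sum sumS) => // b bd.
  apply: (sub_infinite_set _ (dmin b bd)) => n [Dn nI]; split=> //.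
  have [a [t [It tI]]] := DI n Dn; case: (level_dichotomy a t b) => [tQ|Pt].
    by case: nI; exact: embeds_trans It tQ.
  exact: embeds_trans Pt tI.
Qed.

Lemma bsum_level I J : set_ideal I -> set_ideal J ->
  (exists a t, biembeds I (level a t)) -> (exists a t, biembeds J (level a t)) ->
  exists a t, biembeds (bsum I J) (level a t).
Proof.
move=> idI idJ lI lJ; apply: (sum_level (bsum_is_sum I J)) => n _; last by case: n.
exact: pair_family_ideal.
Qed.

Lemma orthogonal_bsum I J : set_ideal I -> set_ideal J ->
  orthogonal (bsum I J) = bsum (orthogonal I) (orthogonal J).
Proof.
move=> idI idJ.
have oP := orthogonal_sumP (bsum_is_sum I J) (fun n _ => pair_family_ideal n idI idJ).
apply/seteqP; split=> A.
  by move=> /oP[_ oA] [|[|//]] n2; exact: (oA _ n2).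
move=> oA; apply/oP; split=> [|[|[|//]] n2]; try exact: (oA _ n2).
by apply/finite_set_natP; exists 2%N => _ [z _ <-] /=; case: (odd z).
Qed.

Lemma orthogonal_level a t : exists b r, biembeds (orthogonal (level a t)) (level b r).
Proof.
case: t => [|[|t]] /=.
- by rewrite orthogonal_hier_dual; exists a, 1%N; split; exact: embeds_refl.
- by exists a, 0%N; split; exact: embeds_refl.
- rewrite orthogonal_bsum; [|exact: hier_dual_ideal|exact: hier_ideal].
  rewrite orthogonal_hier_dual.
  apply: bsum_level; [exact: hier_ideal|exact: hier_dual_ideal| |].
    by exists a, 1%N; split; exact: embeds_refl.
  by exists a, 0%N; split; exact: embeds_refl.
Qed.

Lemma calB_level I : calB I -> exists a t, biembeds I (level a t).
Proof.
suff : calB `<=` [set I | set_ideal I /\ exists a t, biembeds I (level a t)].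
  by move=> BM /BM[].
apply: calB_min.
- split; first exact: Fin_ideal.
  (* For the least [a], [Q a] is the powerset, so [P a] is [Fin]. *)
  have [a _ amin] : exists2 a, [set: W] a & forall b, lt b a -> ~ [set: W] b.
    apply: (wf_min (o1_wf o1)); apply/set0P/eqP => W0; apply: W_uncountable.
    by rewrite W0; exact: countable0.
  exists a, 0%N => /=; rewrite /hier_dual (_ : Q a = setT).
    by rewrite orthogonal_setT; split; exact: embeds_refl.
  by rewrite hierE; apply/seteqP; split=> // A _ k j /amin; case.
- by move=> J [].
- move=> J [idJ [a [t [Jt tJ]]]]; split; first exact: orthogonal_ideal.
  have [b [r [ob bo]]] := orthogonal_level a t.
  exists b, r; split.
    by apply: embeds_trans ob; apply: embeds_orthogonal; [exact: level_ideal|].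
  by apply: (embeds_trans bo); exact: embeds_orthogonal.
- move=> D J S phi p JP sumS.
  have idJ n : D n -> set_ideal (J n) by move=> /JP[].
  split; first exact: (sum_ideal sumS).
  by apply: (sum_level sumS) => // n /JP[].
Qed.

(** * Counting the isomorphism classes *)

Lemma iso_class_level : [set iso_class I | I in calB] `<=`
  range (fun at_ : W * nat => iso_class (level at_.1 at_.2)).
Proof.
move=> _ [I BI <-]; have [a [t [It tI]]] := calB_level BI.
have [idI _ _ _] := calB_tame BI.
have trans (J K L : set (set nat)) : ideal_iso [set: nat] [set: nat] J K ->
    ideal_iso [set: nat] [set: nat] K L -> ideal_iso [set: nat] [set: nat] J L.
  move=> [f [fbij fJK]] [g [gbij gKL]]; exists (g \o f); split.
    exact: set_bij_comp gbij.
  by move=> A _; rewrite fJK// gKL// image_comp.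
exists (a, t) => //=; apply/seteqP; split=> J; apply: trans.
- exact: (embeds_antisym idI (level_ideal a t)).
- exact: (embeds_antisym (level_ideal a t) idI).
Qed.

(** For [a] below [b], an isomorphism between [P b] and [P a] would give [Q a ≼ P b ≼ P a]. *)
Lemma iso_class_hier_dual_inj : injective (fun a => iso_class (P a)).
Proof.
have iso_refl I : iso_class I I.
  by exists id; split=> [|A _]; [split=> // x; exists x|rewrite image_id].
have not_iso a b : lt a b -> ~ iso_class (P b) (P a).
  move=> ab /ideal_iso_embeds ba; apply: (not_hier_embeds_hier_dual (a := a)).
  exact: embeds_trans (hier_embeds_dual ab) ba.
move=> a b ab; case: (o1_total o1 a b) => [lab|//|lba].
  by case: (not_iso _ _ lab); rewrite -ab; exact: iso_refl.
by case: (not_iso _ _ lba); rewrite ab; exact: iso_refl.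
Qed.

Lemma has_card_aleph1_calB : has_card_aleph1 [set iso_class I | I in calB].
Proof.
split=> [cB|U B ncB].
  apply: W_uncountable; have /countable_injP[f finj] := cB.
  apply/countable_injP; exists (fun a => f (iso_class (P a))) => a b _ _ fab.
  apply: iso_class_hier_dual_inj; apply: finj fab; rewrite inE;
    [exists (P a)|exists (P b)] => //; exact: hier_dual_calB.
(* The classes are at most as many as the pairs in [W * nat], which inject into [B] through the
   lexicographic order. *)
apply: card_le_trans (subset_card_le iso_class_level) _.
apply: card_le_trans (card_image_le _ _) _.
have [f [finj Bf]] := o1_injection (o1_lex o1) ncB.
have := inj_card_eq (f := f) (A := setT) (fun x y _ _ => @finj x y).
move=> /card_eqPle[_] /card_le_trans; apply; apply: subset_card_le.
by move=> _ [w _ <-].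
Qed.

End Hierarchy.

Theorem theoremI :
  [/\ has_card_aleph1 [set iso_class I | I in calB],
      forall I, calB I -> Frechet I
    & forall I, calB I -> Fsigmadelta (char_set I)].
Proof.
split=> [|I /calB_tame[]//|I /calB_tame[]//].
have [W [lt [Word ncW]]] := omega1_exists.
have /choice[s sP] := o1_enum Word.
by apply: (has_card_aleph1_calB Word (s := s)) => // a; case: (sP a).
Qed.
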